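(* If $D$ is a strong planar digraph, then $\mathsf{d}_s^-(D)\le 4$. Moreover, $\mathsf{d}_s^-(D)=4$ if and only if $D$ is the complete digraph of order $4$.
   Context: Digraphs are finite, loopless, without parallel arcs. A digraph is strong if for every ordered pair $u,v$ there is a directed $uv$-walk. $D$ is planar if its underlying simple graph is planar. The complete digraph of order $n$ has all arcs $(u,v)$, $u\ne v$. $S\subseteq V(D)$ is in-dominating if every vertex not in $S$ has an out-neighbor in $S$; strong in-dominating if moreover $D\langle S\rangle$ is strong. $\mathsf{d}_s^-(D)$ is the maximum number of classes of a partition of $V(D)$ into strong in-dominating sets. *)

(* Defs.v *)
From HB Require Import structures.
From mathcomp Require Import all_boot all_order all_algebra.
From mathcomp Require Import all_classical all_reals all_analysis.
Import Order.TTheory GRing.Theory Num.Theory.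
Import numFieldNormedType.Exports.

Set Implicit Arguments.
Unset Strict Implicit.
Unset Printing Implicit Defensive.

(* A digraph without parallel arcs on the finite vertex set V is a relation
   D : rel V, where D u v means that (u, v) is an arc; it is loopless when D is
   irreflexive. *)

Definition strong (V : finType) (D : rel V) : bool :=
  [forall u, forall v, connect D u v].

Definition induced (V : finType) (D : rel V) (S : {set V}) :
    rel {x : V | x \in S} :=
  fun x y => D (val x) (val y).

Definition in_dominating (V : finType) (D : rel V) (S : {set V}) : bool :=
  [forall u, (u \notin S) ==> [exists v in S, D u v]].

Definition strong_in_dominating (V : finType) (D : rel V) (S : {set V}) : bool :=
  in_dominating D S && strong (induced D (S := S)).

Definition strong_in_domatic (V : finType) (D : rel V) (P : {set {set V}}) : bool :=
  finset.partition P [set: V] && [forall S in P, strong_in_dominating D S].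

(* The maximum is 0 if there is no such partition; a strong digraph always has
   one, with the single class V when V is nonempty. *)
Definition strong_in_domatic_number (V : finType) (D : rel V) : nat :=
  \max_(P : {set {set V}} | strong_in_domatic D P) #|P|.

Definition complete_digraph (V : finType) (D : rel V) : Prop :=
  forall u v, D u v = (u != v).

Definition underlying (V : finType) (D : rel V) : rel V :=
  fun u v => D u v || D v u.

Definition edges (V : finType) (G : rel V) : {set {set V}} :=
  [set e : {set V} | [exists u, exists v, G u v && (e == [set u; v])]]%SET.

Local Open Scope ring_scope.
Local Open Scope classical_set_scope.

(* [0, 1] is compact and the plane is Hausdorff, so a continuous injection of
   [0, 1] is a homeomorphism onto its image. *)
Definition arc_between (R : realType) (A : set (R * R)) (x y : R * R) : Prop :=
  exists f : R -> R * R,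
    [/\ {within `[0, 1], continuous f},
        {in `[0, 1]%R &, injective f},
        f @` `[0, 1] = A,
        f 0 = x & f 1 = y].

(* The vertex u is drawn as the point p u and the edge e as the set A e, an arc
   between the two ends of e whose interior contains no vertex and no point of
   any other edge. *)
Definition drawing (R : realType) (V : finType) (G : rel V)
    (p : V -> R * R) (A : {set V} -> set (R * R)) : Prop :=
  let inner e := A e `\` p @` [set` e] in
  [/\ injective p,
      forall u v, G u v -> arc_between (A [set u; v]%SET) (p u) (p v),
      forall e w, e \in edges G -> ~ inner e (p w) &
      forall e e', e \in edges G -> e' \in edges G -> e != e' ->
        inner e `&` A e' = set0].

Definition planar_graph (R : realType) (V : finType) (G : rel V) : Prop :=
  exists (p : V -> R * R) (A : {set V} -> set (R * R)), drawing G p A.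

Definition planar (R : realType) (V : finType) (D : rel V) : Prop :=
  planar_graph R (underlying D).

(* Main.v *)
(* Classes of a partition into strong in-dominating sets are connected and
   pairwise adjacent, so five classes form a K5 minor. With four classes, one of
   which contains an arc u v, the sets {u}, {v} and the three other classes form
   a K5 minor as well; hence the four classes are singletons.

   That a drawing in the plane has no K5 minor is van Kampen's parity argument:
   whenever the edges of K5 are drawn as curves, the number of crossings of
   disjoint edges is odd. Disjoint edges of a drawing are at positive distance,
   so every edge can be replaced by a chain of close points, joined by L-shaped
   steps, without creating such crossings. Crossing parities are then bilinear
   expressions in the bits "left of" and "below". Replacing an edge by one
   L-shaped step does not change the total parity, because the edges disjoint
   from it form a triangle; and for single L-shaped steps the total is 1. *)

From Stdlib Require Import Ring.
Require Import Defs.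
From mathcomp Require Import all_boot all_order all_algebra.
From mathcomp Require Import all_classical all_reals all_analysis.
From mathcomp Require Import lra.
Import Order.TTheory GRing.Theory Num.Theory numFieldNormedType.Exports.

Set Implicit Arguments.
Unset Strict Implicit.
Unset Printing Implicit Defensive.

(** * Crossing parities of chains *)

Lemma addb_ring_theory : ring_theory false true addb andb addb id (@eq bool).
Proof. by split=> //; do ?case. Qed.

Add Ring addb_ring : addb_ring_theory
  (decidable bool_eq_ok, constants [bool_cst]).

(* A step from p to q stands for the L-shaped curve that goes horizontally from
   p and then vertically to q; [a] reads "to the left of" and [b] reads "below".
   The bit is the parity of the crossings of the steps p q and u v. *)
Definition step_cross (T : Type) (a b : rel T) (p q u v : T) : bool :=
  ((a u q (+) a v q) && (b u p (+) b u q)) (+)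
  ((b u p (+) b v p) && (a v p (+) a v q)).

(* The L-shaped drawing of K5 has an odd number of crossings of disjoint edges.
   As an identity over F_2 this needs [a] and [b] to be antisymmetric only. *)
Lemma step_cross_tournament (T : Type) (a b : rel T) (q : nat -> T) :
  (forall i j, i < j < 5 ->
     a (q j) (q i) = ~~ a (q i) (q j) /\ b (q j) (q i) = ~~ b (q i) (q j)) ->
  let X i j k l := step_cross a b (q i) (q j) (q k) (q l) in
  X 0 1 2 3 (+) X 0 1 2 4 (+) X 0 1 3 4 (+) X 0 2 1 3 (+) X 0 2 1 4 (+) X 0 2 3 4
  (+) X 0 3 1 2 (+) X 0 3 1 4 (+) X 0 3 2 4 (+) X 0 4 1 2 (+) X 0 4 1 3
  (+) X 0 4 2 3 (+) X 1 2 3 4 (+) X 1 3 2 4 (+) X 1 4 2 3 = true.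
Proof.
move=> asym; rewrite /step_cross /=.
have [a10 b10] := asym 0 1 isT; have [a20 b20] := asym 0 2 isT.
have [a30 b30] := asym 0 3 isT; have [a40 b40] := asym 0 4 isT.
have [a21 b21] := asym 1 2 isT; have [a31 b31] := asym 1 3 isT.
have [a41 b41] := asym 1 4 isT; have [a32 b32] := asym 2 3 isT.
have [a42 b42] := asym 2 4 isT; have [a43 b43] := asym 3 4 isT.
rewrite ?(a10, a20, a30, a40, a21, a31, a41, a32, a42, a43).
rewrite ?(b10, b20, b30, b40, b21, b31, b41, b32, b42, b43) -?addTb.
ring.
Qed.

Section Chains.
Variable T : eqType.
Implicit Types (f : T -> T -> bool) (p q u v : T) (s t : seq T).

Fixpoint along f p s : bool :=
  if s is q :: s' then f p q (+) along f q s' else false.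

Lemma eq_along f g p s : f =2 g -> along f p s = along g p s.
Proof. by move=> fg; elim: s p => //= q s IHs p; rewrite fg IHs. Qed.

Lemma eq_in_along f g p s :
  {in p :: s &, f =2 g} -> along f p s = along g p s.
Proof.
elim: s p => //= q s IHs p fg; congr (_ (+) _).
  by apply: fg; rewrite !inE eqxx ?orbT.
by apply: IHs => x y xs ys; apply: fg; rewrite inE ?xs ?ys orbT.
Qed.

Lemma along_addb f g p s :
  along (fun x y => f x y (+) g x y) p s = along f p s (+) along g p s.
Proof. by elim: s p => //= q s IHs p; rewrite IHs; ring. Qed.

Lemma along_diff (d : T -> bool) p s :
  along (fun x y => d x (+) d y) p s = d p (+) d (last p s).
Proof.
elim: s p => [|q s IHs] p /=; first by rewrite addbb.
by rewrite IHs; ring.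
Qed.

Variables a b : rel T.

Definition cross p s u t : bool :=
  along (fun u v => along (fun p q => step_cross a b p q u v) p s) u t.

(* Parity of the crossings of the chain with the horizontal ray going right
   from u. *)
Definition ray_parity p s u : bool :=
  along (fun p q => a u q && (b u p (+) b u q)) p s.

(** Modulo 2, the step [u v] and the rays going right from [u] and [v] bound the half-strip to the
    right of the step. The last two terms tell whether the ends of the chain lie in it. *)
Lemma along_step_cross p s u v :
  along (fun p q => step_cross a b p q u v) p s =
  ray_parity p s u (+) ray_parity p s v
  (+) (a v p && (b u p (+) b v p))
  (+) (a v (last p s) && (b u (last p s) (+) b v (last p s))).
Proof.
have := along_diff (fun p => a v p && (b u p (+) b v p)) p s.
rewrite -!addbA => <-; rewrite -!along_addb.
by apply: eq_along => x y; rewrite /step_cross; ring.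
Qed.

(* Two chains with the same ends form a closed curve, whose crossings with u t
   are counted by the change of the ray parity between the ends of u t. *)
Lemma cross_same_ends p s s' u t : last p s = last p s' ->
  let d x := ray_parity p s x (+) ray_parity p s' x in
  cross p s u t = cross p s' u t (+) d u (+) d (last u t).
Proof.
move=> eq_last d.
have E : cross p s u t (+) cross p s' u t = d u (+) d (last u t).
  rewrite -along_addb -along_diff; apply: eq_along => x y.
  by rewrite !along_step_cross eq_last /d; ring.
by rewrite -addbA -E; ring.
Qed.

Definition generic p u := a p u = ~~ a u p /\ b p u = ~~ b u p.

(** The exchange swaps the two products, and the negations cancel in pairs. *)
Lemma step_crossC p q u v :
  generic p u -> generic p v -> generic q u -> generic q v ->
  step_cross a b p q u v = step_cross a b u v p q.
Proof.
rewrite /step_cross => -[? pu] [pv pv'] [qu qu'] [qv ?].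
rewrite pu pv pv' qu qu' qv.
by rewrite -!addTb; ring.
Qed.

Lemma cross_stepC p q u t :
  {in u :: t, forall x, generic p x /\ generic q x} ->
  cross p [:: q] u t = cross u t p [:: q].
Proof.
move=> gen; rewrite /cross /= addbF; apply: eq_in_along => x y.
move=> /gen[px qx] /gen[py qy] /=.
by rewrite addbF step_crossC.
Qed.

(** Only a straight step is ever exchanged with a chain, so genericity is asked only of a branch
    point against the chains of edges that avoid it. *)
Lemma disjoint_edges_cross (q : nat -> T) (g : nat -> nat -> seq T) :
  (forall i j, i < j < 5 -> last (q i) (g i j) = q j) ->
  (forall i k l z, k < l < 5 -> i < 5 -> i != k -> i != l ->
     z \in q k :: g k l -> generic (q i) z) ->
  exists i j k l, [/\ i < j < 5, k < l < 5, uniq [:: i; j; k; l] &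
    cross (q i) (g i j) (q k) (g k l)].
Proof.
move=> lastg gen; apply: contrapT => no_cross.
pose d i j x :=
  ray_parity (q i) (g i j) (q x) (+) ray_parity (q i) [:: q j] (q x).
(* Straightening both edges changes their crossing parity by terms d e x with x
   an end of the other edge; over all 15 pairs of disjoint edges, each d e x
   occurs twice. *)
have E i j k l : i < j < 5 -> k < l < 5 -> uniq [:: i; j; k; l] ->
  step_cross a b (q k) (q l) (q i) (q j) =
  d i j k (+) d i j l (+) d k l i (+) d k l j.
  move=> ij kl uniq_ijkl.
  have : cross (q i) (g i j) (q k) (g k l) = false.
    by apply/negP => c; apply: no_cross; exists i, j, k, l.
  rewrite (cross_same_ends (s' := [:: q j])) ?lastg //= cross_stepC; last first.
    move: uniq_ijkl; rewrite /= !inE !negb_or -!andbA.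
    move=> /and5P[_ ik il jk /and3P[jl _ _]].
    case/andP: (ij) => lt_ij lt_j z zkl.
    by split; apply: (gen _ k l) => //; apply: ltn_trans lt_j.
  rewrite (cross_same_ends (s' := [:: q l])) ?lastg //=.
  rewrite /cross /= !addbF -/(d i j k) -/(d i j l) -/(d k l i) -/(d k l j).
  move=> E0; rewrite -[RHS]addFb -E0; ring.
(* [gen] needs an edge with end [i] that avoids [j]: from 0 to 1 or 2 if [i] is 0, and from 0 to [i]
   otherwise. *)
have genq i j : i < j < 5 -> generic (q j) (q i).
  case/andP => ij j5; have [i0 | i_gt0] := posnP i.
    have j_gt0 : 0 < j by rewrite -i0.
    rewrite i0; apply: (gen _ 0 (j == 1).+1); rewrite ?inE ?eqxx //.
    - by case: eqP.
    - by rewrite -lt0n.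
    - by have [->|] := eqVneq j 1.
  have i5 : i < 5 by apply: ltn_trans ij j5.
  apply: (gen _ 0 i); rewrite ?i_gt0 //.
  - by rewrite -lt0n (leq_ltn_trans _ ij).
  - by rewrite gtn_eqF.
  - by rewrite -(lastg 0 i) ?i_gt0 // mem_last.
have := step_cross_tournament genq.
rewrite /= !E // => sum_true.
by suff: false = true by []; rewrite -[RHS]sum_true; ring.
Qed.
End Chains.

(** * Chains of close points in the plane *)

Section Plane.
Local Open Scope ring_scope.
Local Open Scope classical_set_scope.

(** A point of [A] has a ball that misses the closed set [B]; half its radius works for all points
    nearby, and compactness makes the bound uniform. *)
Lemma compact_separated (R : realType) (V : normedModType R) (A B : set V) :
  compact A -> compact B -> A `&` B = set0 ->
  \forall e \near 0^'+, forall x y, A x -> B y -> e <= `|x - y|.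
Proof.
move=> cA cB AB0.
have clB : closed B by apply: compact_closed => //; exact: norm_hausdorff.
have /compact_near_coveringP/(_ R 0^'+
  (fun e x => forall y, B y -> e <= `|x - y|)) covA := cA.
have : \forall e \near 0^'+, A `<=` (fun x => forall y, B y -> e <= `|x - y|).
  apply: covA => x Ax.
  have nBx : (~` B) x by move=> Bx; have : (A `&` B) x by []; rewrite AB0.
  have /nbhs_ballP[r /= r0 xrB] : nbhs x (~` B).
    by apply: open_nbhs_nbhs; split => //; rewrite openC.
  have r20 : 0 < r / 2 by lra.
  exists (ball x (r / 2), [set e | e < r / 2]) => /=.
    by split; [exact: nbhsx_ballx | exact: nbhs_right_lt].
  move=> [x' e] /= [xx' er] y By.
  have ry : r <= `|x - y|.
    by rewrite leNgt; apply/negP => xy; apply: (xrB y) By; rewrite -ball_normE.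
  move: xx'; rewrite -ball_normE /= => xx'.
  have := ler_distD x' x y; lra.
apply: filterS => e Ae x y Ax By; exact: Ae.
Qed.

(** The same covering argument: half the radius of continuity at [s] serves every point near [s]. *)
Lemma segment_uniformly_continuous (R : realType) (V : normedModType R)
    (f : R -> V) (e : R) : {within `[0, 1], continuous f} -> 0 < e ->
  \forall d \near 0^'+, forall s t, s \in `[0, 1]%R -> t \in `[0, 1]%R ->
    `|s - t| < d -> `|f s - f t| < e.
Proof.
move=> cf e0.
have := @segment_compact R 0 1.
move=> /compact_near_coveringP/near_covering_withinP/(_ R 0^'+
  (fun d s => forall t, t \in `[0, 1]%R -> `|s - t| < d -> `|f s - f t| < e)) cov.
have : \forall d \near 0^'+, `[0, 1] `<=` (fun s => forall t, t \in `[0, 1]%R ->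
    `|s - t| < d -> `|f s - f t| < e).
  apply: cov => s s01.
  have e20 : 0 < e / 2 by lra.
  have /subspace_continuousP/(_ s s01)/cvgrPdist_lt/(_ _ e20) := cf.
  rewrite nearE /= => /nbhs_ballP[r /= r0 fr].
  have r20 : 0 < r / 2 by lra.
  exists (ball s (r / 2), [set d | d < r / 2]) => /=.
    by split; [exact: nbhsx_ballx | exact: nbhs_right_lt].
  move=> [s' d] /= [ss' dr] s'01 t t01 s't.
  rewrite -ball_normE /= in ss' fr.
  have fs' : `|f s - f s'| < e / 2 by apply: fr => //=; lra.
  have ft : `|f s - f t| < e / 2.
    by apply: fr => //=; have := ler_distD s' s t; lra.
  by have := ler_distD (f s) (f s') (f t); rewrite (distrC (f s') (f s)); lra.
by apply: filterS => d H s t s01 t01; apply: H.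
Qed.

Definition echain (R : realType) (V : normedModType R) (e : R) (A : set V)
    (x y : V) :=
  exists s, [/\ path (fun u v => `|u - v| < e) x s, last x s = y &
    {in s, forall z, A z}].

Lemma echain_trans (R : realType) (V : normedModType R) (e : R) (A : set V) x y z :
  echain e A x y -> echain e A y z -> echain e A x z.
Proof.
move=> [s [xs <- sA]] [t [st <- tA]]; exists (s ++ t); split.
- by rewrite cat_path xs.
- by rewrite last_cat.
- by move=> w; rewrite mem_cat => /orP[/sA|/tA].
Qed.

Lemma curve_echain (R : realType) (V : normedModType R) (f : R -> V) (e : R) :
  {within `[0, 1], continuous f} -> 0 < e -> echain e (f @` `[0, 1]) (f 0) (f 1).
Proof.
move=> cf e0.
have [d [d0 fd]] : exists d, 0 < d /\ forall s t,
    s \in `[0, 1]%R -> t \in `[0, 1]%R -> `|s - t| < d -> `|f s - f t| < e.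
  have : \forall d \near 0^'+, 0 < d /\ forall s t,
    s \in `[0, 1]%R -> t \in `[0, 1]%R -> `|s - t| < d -> `|f s - f t| < e.
    near=> d; split => //; near: d; exact: segment_uniformly_continuous.
  by move/filter_ex.
(* Since [n] exceeds [d^-1], consecutive sample points k / n are closer than [d]. *)
pose n := (Num.truncn d^-1).+1.
have n0 : (0 : R) < n%:R by rewrite ltr0n.
have nd : n%:R^-1 < d.
  by rewrite invf_plt ?posrE // /n truncnS_gt.
suff H k : (k <= n)%N -> echain e (f @` `[0, 1]) (f 0) (f (k%:R / n%:R)).
  by have := H n (leqnn n); rewrite divff ?gt_eqF.
have in01 m : (m <= n)%N -> (m%:R / n%:R : R) \in `[0, 1]%R.
  move=> mn.
  by rewrite in_itv /= divr_ge0 ?ler0n //= ler_pdivrMr // mul1r ler_nat.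
elim: k => [|k IHk] kn; first by exists [::]; rewrite mul0r.
apply: echain_trans (IHk (ltnW kn)) _.
exists [:: f (k.+1%:R / n%:R)]; split => //=.
  rewrite andbT; apply: fd; rewrite ?in01 ?(ltnW kn) //.
  rewrite -natr1 mulrDl opprD addrA subrr add0r normrN mul1r.
  by rewrite gtr0_norm ?invr_gt0.
by move=> z; rewrite inE => /eqP ->; exists (k.+1%:R / n%:R) => //; exact: in01.
Unshelve. all: by end_near.
Qed.

(** * General position by tie-breaking tags *)

Section TaggedPoints.
Variable R : realType.
Implicit Types (x y z : R) (m n k : nat).

(* The tags break ties, so that points with distinct tags are in general
   position without being moved. *)
Definition lex x m y n := (x < y) || (x == y) && (m < n)%N.

Lemma lex_neg x m y n : m != n -> lex x m y n = ~~ lex y n x m.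
Proof. by rewrite /lex; case: (ltgtP x y) => //= _; case: ltngtP. Qed.

Lemma lex_between_r x m y n z k : lex x m y n (+) lex z k y n ->
  (x <= y <= z) || (z <= y <= x).
Proof. by rewrite /lex; case: (ltgtP x y); case: (ltgtP z y). Qed.

Lemma lex_between_l x m y n z k : lex y n x m (+) lex y n z k ->
  (x <= y <= z) || (z <= y <= x).
Proof. by rewrite /lex; case: (ltgtP x y); case: (ltgtP z y). Qed.

Definition left_of (u v : R * R * nat) := lex u.1.1 u.2 v.1.1 v.2.
Definition below (u v : R * R * nat) := lex u.1.2 u.2 v.1.2 v.2.

Lemma generic_tag (u v : R * R * nat) : u.2 != v.2 -> generic left_of below u v.
Proof. by move=> uv; split; apply: lex_neg. Qed.

Lemma norm_pair_lt (x : R * R) (e : R) :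
  (`|x| < e) = (`|x.1| < e) && (`|x.2| < e).
Proof. by rewrite prod_normE /= gt_max. Qed.

(** The horizontal part of one step meets the vertical part of the other, up to ties, in a point
    within [e] of both [p] and [u] in the max norm. *)
Lemma step_cross_close (e : R) (p q u v : R * R * nat) :
  `|p.1 - q.1| < e -> `|u.1 - v.1| < e -> step_cross left_of below p q u v ->
  `|p.1 - u.1| < 2 * e.
Proof.
case: p q u v => [[p1 p2] mp] [[q1 q2] mq] [[u1 u2] mu] [[v1 v2] mv].
rewrite !norm_pair_lt /= !ltr_norml.
move=> /andP[/andP[? ?] /andP[? ?]] /andP[/andP[? ?] /andP[? ?]].
rewrite /step_cross /left_of /below /=.
move=> crossed; have : (lex u1 mu q1 mq (+) lex v1 mv q1 mq) &&
    (lex u2 mu p2 mp (+) lex u2 mu q2 mq) \/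
  (lex u2 mu p2 mp (+) lex v2 mv p2 mp) && (lex v1 mv p1 mp (+) lex v1 mv q1 mq).
  by move: crossed; case: (_ && _) => /=; [left | right].
by case=> /andP[/lex_between_r/orP[]/andP[? ?] /lex_between_l/orP[]/andP[? ?]];
  apply/andP; split; apply/andP; split; lra.
Qed.
End TaggedPoints.

Lemma along_true (T : eqType) (f e : rel T) x s : along f x s -> path e x s ->
  exists y z, [/\ y \in x :: s, z \in x :: s, f y z & e y z].
Proof.
elim: s x => //= z s IHs x; case: (boolP (f x z)) => [fxz _ /andP[exz _]|_].
  by exists x, z; rewrite !inE !eqxx orbT.
move=> /IHs + /andP[_ zs] => /(_ zs)[y [w [ys ws fyw eyw]]].
by exists y, w; split=> //; rewrite inE (ys, ws) orbT.
Qed.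

Lemma cross_close (R : realType) (e : R) p s u t :
  let near_pt := relpre fst (fun x y : R * R => `|x - y| < e) in
  path near_pt p s -> path near_pt u t ->
  cross (@left_of R) (@below R) p s u t ->
  exists x y, [/\ x \in p :: s, y \in u :: t & `|x.1 - y.1| < 2 * e].
Proof.
move=> near_pt ps ut /along_true/(_ ut)[u' [v' [u't _ /along_true/(_ ps) + uv]]].
move=> [p' [q' [p's _ pquv pq]]].
by exists p', u'; split=> //; apply: step_cross_close pquv.
Qed.

(** * Drawings *)

(** Unlike [induced], this stays on the type [V], so that walks inside different sets can be
    concatenated. *)
Definition restricted (V : finType) (G : rel V) (S : {set V}) : rel V :=
  [rel u v | [&& u \in S, v \in S & G u v]].

Lemma sub_restricted (V : finType) (G : rel V) (S S' : {set V}) :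
  (S \subset S')%SET -> subrel (connect (restricted G S)) (connect (restricted G S')).
Proof.
move=> /fintype.subsetP SS'; apply: connect_sub => u v /and3P[uS vS uv].
by apply: connect1; apply/and3P; rewrite !SS'.
Qed.

Section Drawing.
Variables (R : realType) (V : finType) (G : rel V).
Variables (p : V -> R * R) (A : {set V} -> set (R * R)).
Hypothesis dr : drawing G p A.

Lemma mem_edges u v : G u v -> [set u; v]%SET \in edges G.
Proof.
move=> uv; rewrite inE; apply/existsP; exists u; apply/existsP; exists v.
by rewrite uv /=.
Qed.

Lemma edgesP e : e \in edges G -> exists u v, G u v /\ e = [set u; v]%SET.
Proof.
by rewrite inE => /existsP[u /existsP[v /andP[uv /eqP ->]]]; exists u, v.
Qed.

Lemma edge_compact e : e \in edges G -> compact (A e).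
Proof.
case: dr => _ arcs _ _ /edgesP[u [v [uv ->]]].
have [f [cf _ <- _ _]] := arcs _ _ uv.
by apply: continuous_compact => //; exact: segment_compact.
Qed.

(** A common point that is an end of [e] would be a vertex in the interior of [e']; any other common
    point is interior to [e] and lies on another edge. *)
Lemma edge_disjoint e e' : e \in edges G -> e' \in edges G ->
  [disjoint e & e']%B -> A e `&` A e' = set0.
Proof.
case: dr => p_inj _ vtx inner0 eG e'G dis; apply/seteqP; split=> // z [Aez Ae'z].
have ee' : e != e'.
  case/edgesP: (eG) dis => u [v [_ ->]]; apply: contraTneq => <-.
  by apply/negP => /disjointFr/(_ (set21 u v)); rewrite set21.
case: (pselect ((p @` [set` e]) z)) => [[w /= we pw]|nz]; last first.
  by rewrite -(inner0 _ _ eG e'G ee').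
apply: (vtx _ w e'G); rewrite pw; split=> // -[w' /= w'e'].
rewrite -pw => /p_inj ww'; rewrite ww' in w'e'.
by rewrite (disjointFr dis we) in w'e'.
Qed.

Lemma edges_separated : exists2 d : R, 0 < d & forall e e' x y,
  e \in edges G -> e' \in edges G -> [disjoint e & e']%B -> A e x -> A e' y ->
  d <= `|x - y|.
Proof.
pose sep (ee : {set V} * {set V}) (d : R) := forall x y,
  ee.1 \in edges G -> ee.2 \in edges G -> [disjoint ee.1 & ee.2]%B ->
  A ee.1 x -> A ee.2 y -> d <= `|x - y|.
have sep_near ee : \forall d \near 0^'+, sep ee d.
  case: ee => e e'; rewrite /sep /=.
  have [/and3P[eG e'G dis]|nee] :=
    boolP [&& e \in edges G, e' \in edges G & [disjoint e & e']%B].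
    have := compact_separated (edge_compact eG) (edge_compact e'G)
      (edge_disjoint eG e'G dis).
    by apply: filterS => d sep_d x y _ _ _; apply: sep_d.
  by apply: filterE => d x y eG e'G dis; rewrite eG e'G dis in nee.
have : \forall d \near 0^'+, 0 < d /\ forall ee, sep ee d.
  by apply: filterI; [exact: nbhs_right_gt | exact: (filter_forall _ sep_near)].
move=> /filter_ex[d [d0 sep_d]]; exists d => // e e' x y.
exact: (sep_d (e, e') x y).
Qed.

Definition edge_points (S : {set V}) : set (R * R) :=
  [set z | exists e, [/\ e \in edges G, (e \subset S)%SET & A e z]].

Lemma restricted_edge S u v : restricted G S u v ->
  A [set u; v]%SET `<=` edge_points S.
Proof.
move=> /and3P[uS vS uv] z Az; exists [set u; v]%SET; split=> //.
  exact: mem_edges.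
by rewrite finset.subUset !finset.sub1set uS.
Qed.

(** Since [x != y], the walk has a first edge, which contains [p x]; [echain] itself says nothing
    about its starting point. *)
Lemma edge_points_chain (e : R) S x y : 0 < e -> x != y ->
  connect (restricted G S) x y ->
  edge_points S (p x) /\ echain e (edge_points S) (p x) (p y).
Proof.
move=> e0 xy /connectP[s xs ys]; case: dr => _ arcs _ _; split.
  case: s xs ys => [_ yx|u s /= /andP[xu _] _]; first by rewrite yx eqxx in xy.
  have /arcs[f [_ _ fA f0 _]] : G x u by case/and3P: xu.
  apply: (restricted_edge xu); rewrite -fA -f0.
  by exists 0; rewrite //= in_itv /= lexx ler01.
elim: s x xs ys {xy} => [|u s IHs] x /=; first by move=> _ ->; exists [::].
move=> /andP[xu us] /(IHs _ us) uy; apply: echain_trans uy.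
have /arcs[f [cf _ fA <- <-]] : G x u by case/and3P: xu.
have [t [xt tl tA]] := curve_echain cf e0; exists t; split=> // z zt.
by apply: (restricted_edge xu); rewrite -fA; apply: tA.
Qed.

Lemma drawing_no_K5_minor (B : nat -> {set V}) :
  (forall i, (i < 5)%N -> B i != finset.set0) ->
  (forall i x y, (i < 5)%N -> x \in B i -> y \in B i ->
     connect (restricted G (B i)) x y) ->
  (forall i j, (i < j < 5)%N -> [disjoint B i & B j]%B) ->
  (forall i j, (i < j < 5)%N -> exists u v, [/\ u \in B i, v \in B j & G u v]) ->
  False.
Proof.
move=> B_neq0 B_conn B_disj B_adj.
have [x0 _] : exists x0, x0 \in B 0 by apply/set0Pn/B_neq0.
pose r i := odflt x0 [pick x in B i].
have rB i : (i < 5)%N -> r i \in B i.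
  by rewrite /r => /B_neq0/set0Pn[x xB]; case: pickP => // /(_ x); rewrite xB.
have [d d0 sep] := edges_separated.
(* [cross_close] loses a factor 2, so steps shorter than [d / 2] put crossing chains at distance
   less than [d]. *)
have e0 : 0 < d / 2 by lra.
(* The edge ij of K5 is a walk inside B i :|: B j, so that disjoint edges of K5
   run through disjoint edges of G. *)
pose K i j := edge_points (B i :|: B j)%SET.
have chain (ij : nat * nat) : exists s, (ij.1 < ij.2 < 5)%N ->
  [/\ K ij.1 ij.2 (p (r ij.1)),
    path (fun x y : R * R => `|x - y| < d / 2) (p (r ij.1)) s,
    last (p (r ij.1)) s = p (r ij.2) & {in s, forall z, K ij.1 ij.2 z}].
  case: ij => i j /=; case: (boolP (i < j < 5)%N) => [ij|_]; last by exists [::].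
  have /andP[lt_ij j5] := ij; have i5 := ltn_trans lt_ij j5.
  have rij : r i != r j.
    by apply/eqP => E; have := disjointFr (B_disj _ _ ij) (rB _ i5); rewrite E rB.
  have [u [v [uB vB uv]]] := B_adj _ _ ij.
  have conn : connect (restricted G (B i :|: B j)%SET) (r i) (r j).
    have ui := sub_restricted (finset.subsetUl (B i) (B j))
      (B_conn _ _ _ i5 (rB _ i5) uB).
    have vj := sub_restricted (finset.subsetUr (B i) (B j))
      (B_conn _ _ _ j5 vB (rB _ j5)).
    apply: connect_trans ui (connect_trans _ vj); apply: connect1.
    by apply/and3P; rewrite !inE uB vB orbT.
  by have [Ki [s [*]]] := edge_points_chain e0 rij conn; exists s.
have [g gP] := choice chain.
(* Branch points get distinct positive tags and chain points get tag 0, so a branch point is generic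
   to every chain of an edge avoiding it. Appending [q j] repeats the last point with its proper
   tag, by a step of length 0. *)
pose q i := (p (r i), i.+1).
pose c i j := rcons [seq (z, 0%N) | z <- g (i, j)] (q j).
have c_fst i j : map fst (c i j) = rcons (g (i, j)) (p (r j)).
  by rewrite map_rcons -map_comp map_id.
have c_path i j : (i < j < 5)%N ->
    path (relpre fst (fun x y : R * R => `|x - y| < d / 2)) (q i) (c i j).
  move=> /(gP (i, j))[/= _ gpath glast _].
  by rewrite -path_map c_fst rcons_path gpath /= glast subrr normr0.
have c_K i j z : (i < j < 5)%N -> z \in q i :: c i j -> K i j z.1.
  move=> ij zc; have := map_f fst zc; rewrite map_cons c_fst.
  have [/= Kr _ glast gK] := gP (i, j) ij.
  rewrite -rcons_cons mem_rcons inE => /orP[/eqP -> | ].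
    rewrite -glast; have := mem_last (p (r i)) (g (i, j)).
    by rewrite inE => /orP[/eqP -> | /gK].
  by rewrite inE => /orP[/eqP -> | /gK].
have [||i [j [k [l [ij kl uniq_ijkl /cross_close]]]]] :=
  @disjoint_edges_cross _ (@left_of R) (@below R) q c.
- by move=> i j _; rewrite last_rcons.
- move=> i k l z _ _ ik il zc; apply: generic_tag => /=.
  move: zc; rewrite inE mem_rcons inE => /or3P[/eqP ->|/eqP ->|/mapP[w _ ->]] //=.
move=> /(_ (d / 2) (c_path _ _ ij) (c_path _ _ kl))[x [y [xc yc xy]]].
have [e [eG eB Ae]] := c_K _ _ _ ij xc.
have [e' [e'G e'B Ae']] := c_K _ _ _ kl yc.
suff dis : [disjoint e & e']%B by have := sep _ _ _ _ eG e'G dis Ae Ae'; lra.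
have disB a b : (a < 5)%N -> (b < 5)%N -> a != b -> [disjoint B a & B b]%B.
  move=> a5 b5; rewrite neq_ltn => /orP[ab|ba]; first by apply: B_disj; rewrite ab.
  by rewrite disjoint_sym B_disj ?ba.
apply: disjointWl eB _; apply: disjointWr e'B _.
case/andP: ij kl => ij j5 /andP[kl l5].
move: uniq_ijkl; rewrite /= !inE !negb_or -!andbA.
move=> /and5P[_ ik il jk /and3P[jl _ _]].
have i5 := ltn_trans ij j5; have k5 := ltn_trans kl l5.
rewrite -finset.setI_eq0 finset.setIUl !finset.setIUr !finset.setU_eq0.
by rewrite !finset.setI_eq0 !disB.
Qed.
End Drawing.

End Plane.

(** * Partitions into strong in-dominating sets *)

Definition touching (V : finType) (G : rel V) : rel {set V} :=
  fun S S' => [disjoint S & S'] && [exists u in S, exists v in S', G u v].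

Lemma planar_no_K5_minor (R : realType) (V : finType) (G : rel V)
    (Bs : seq {set V}) : planar_graph R G -> 4 < size Bs ->
  {in Bs, forall S, S != finset.set0 /\
     {in S &, forall x y, connect (restricted G S) x y}} ->
  ~ pairwise (touching G) Bs.
Proof.
move=> [p [A dr]] Bs5 Bs_conn Bs_touch.
pose B := nth finset.set0 Bs.
have memB i : i < 5 -> B i \in Bs.
  by move=> i5; apply: mem_nth; apply: leq_trans Bs5.
have touchB i j : i < j < 5 -> touching G (B i) (B j).
  case/andP=> ij j5; have j_lt := leq_trans j5 Bs5.
  have /(pairwiseP finset.set0) nth_touch := Bs_touch.
  by apply: nth_touch; rewrite // inE (ltn_trans ij).
apply: (@drawing_no_K5_minor R V G p A dr B) => [i|i x y|i j|i j].
- by move=> /memB/Bs_conn[].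
- by move=> /memB/Bs_conn[_]; apply.
- by move=> /touchB/andP[].
- by move=> /touchB/andP[_ /exists_inP[u uB /exists_inP[v vB uv]]]; exists u, v.
Qed.

Section Domatic.
Variables (V : finType) (D : rel V).

Lemma strong_restricted (S : {set V}) : strong (Defs.induced D (S := S)) ->
  {in S &, forall x y, connect (restricted D S) x y}.
Proof.
move=> /forallP str x y xS yS.
have /forallP/(_ (exist _ y yS))/connectP[s] := str (exist _ x xS).
move=> xs ys; suff H (u : {x | x \in S}) : path (Defs.induced D (S := S)) u s ->
    connect (restricted D S) (val u) (val (last u s)).
  by move: (H _ xs); rewrite -ys.
elim: s u {xs ys} => [|w s IHs] u /=; first by rewrite connect0.
case/andP=> uw ws; apply: connect_trans (IHs w ws); apply: connect1.
by apply/and3P; split; [exact: valP | exact: valP | exact: uw].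
Qed.

Lemma sub_restricted_rel (G G' : rel V) (S : {set V}) : subrel G G' ->
  subrel (connect (restricted G S)) (connect (restricted G' S)).
Proof.
move=> GG'; apply: connect_sub => u v /and3P[uS vS uv].
by apply: connect1; apply/and3P; rewrite uS vS GG'.
Qed.

Lemma sub_underlying : subrel D (underlying D).
Proof. by move=> u v; rewrite /underlying => ->. Qed.

Variable P : {set {set V}}.
Hypothesis domP : strong_in_domatic D P.

Lemma domatic_disjoint S S' :
  S \in P -> S' \in P -> S != S' -> [disjoint S & S'].
Proof.
by move: domP => /andP[/and3P[_ /finset.trivIsetP trivP _] _]; exact: trivP.
Qed.

Lemma domatic_class S : S \in P -> S != finset.set0 /\
  {in S &, forall x y, connect (restricted (underlying D) S) x y}.
Proof.
move: domP => /andP[/and3P[_ _ P0] /forall_inP domS] SP; split.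
  by apply: contraNneq P0 => <-.
move=> x y xS yS; apply: sub_restricted_rel sub_underlying _ _ _.
by have /andP[_ /strong_restricted] := domS S SP; apply.
Qed.

Lemma domatic_dominating S u :
  S \in P -> u \notin S -> exists2 v, v \in S & D u v.
Proof.
move: domP => /andP[_ /forall_inP domS] SP uS.
have /andP[/forallP/(_ u)/implyP/(_ uS)/exists_inP[v vS uv] _] := domS S SP.
by exists v.
Qed.

(** Every vertex outside [S'] has an out-neighbor in [S'], so a single vertex of [B] already gives
    the adjacency. *)
Lemma touching_subclass S S' (B : {set V}) : S \in P -> S' \in P -> S != S' ->
  B \subset S -> B != finset.set0 -> touching (underlying D) B S'.
Proof.
move=> SP S'P SS' BS /set0Pn[u uB].
have dis := domatic_disjoint SP S'P SS'.
have uS : u \in S by move/fintype.subsetP: BS; apply.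
rewrite /touching /= (disjointWl BS dis) /=.
have [v vS' uv] := domatic_dominating S'P (negbT (disjointFr dis uS)).
apply/exists_inP; exists u => //.
by apply/exists_inP; exists v; rewrite ?sub_underlying.
Qed.

Lemma pairwise_touching_enum (Q : {set {set V}}) : Q \subset P ->
  pairwise (touching (underlying D)) (enum Q).
Proof.
move=> /fintype.subsetP QP; have: pairwise [rel S S' | S != S'] (enum Q).
  by rewrite -uniq_pairwise enum_uniq.
apply: (@sub_in_pairwise _ (mem P)); last first.
  by apply/allP => S; rewrite mem_enum => /QP.
move=> S S' SP S'P /= SS'.
by apply: (touching_subclass SP S'P SS') => //; have [] := domatic_class SP.
Qed.

Variable R : realType.
Hypothesis planarD : planar R D.

Lemma planar_domatic_le4 : #|P| <= 4.
Proof.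
rewrite leqNgt; apply/negP => P5.
apply: (planar_no_K5_minor (Bs := enum P) planarD); rewrite -?cardE //.
  by move=> S; rewrite mem_enum => /domatic_class.
exact: pairwise_touching_enum.
Qed.

Hypothesis D_loopless : irreflexive D.

(* An arc u v inside a class S gives a K5 minor: every class but S is next to
   both u and v, and the rest of S is dropped. *)
Lemma planar_domatic_singletons S : 4 <= #|P| -> S \in P -> #|S| = 1.
Proof.
move=> P4 SP; apply/eqP; rewrite eqn_leq card_gt0.
have [-> S_conn] := domatic_class SP; rewrite andbT leqNgt; apply/negP.
move=> /card_gt1P[u [w [uS wS uw]]].
(* [w] need not be adjacent to [u]; the second vertex of a walk from [u] to [w] inside [S] is. *)
have [v [vS uv]] : exists v, v \in S /\ underlying D u v.
  have /connectP[[|v s] /= us] := S_conn u w uS wS.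
    by move=> wu; rewrite wu eqxx in uw.
  by case/andP: us => /and3P[_ vS uv] _; exists v.
have u_neq_v : u != v.
  by apply: contraTneq uv => <-; rewrite /underlying D_loopless.
pose Bs := [set u] :: [set v] :: enum (P :\ S).
apply: (planar_no_K5_minor (Bs := Bs) planarD).
- by rewrite /= -cardE; move: P4; rewrite (cardsD1 S) SP.
- have conn1 x : [set x] != finset.set0 /\
      {in [set x] &, forall y z, connect (restricted (underlying D) [set x]) y z}.
    split; first by rewrite -card_gt0 cards1.
    by move=> y z /set1P -> /set1P ->.
  move=> B; rewrite !inE mem_enum !inE => /or3P[/eqP -> | /eqP -> | /andP[_]] //.
  exact: domatic_class.
have touch1 x : x \in S -> all (touching (underlying D) [set x]) (enum (P :\ S)).
  move=> xS; apply/allP => S'; rewrite mem_enum !inE => /andP[S'S S'P].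
  apply: (touching_subclass SP S'P); rewrite ?finset.sub1set //.
    by rewrite eq_sym.
  by rewrite -card_gt0 cards1.
rewrite /= !touch1 // pairwise_touching_enum ?finset.subD1set // !andbT.
rewrite /touching /= disjoints1 inE u_neq_v /=.
apply/exists_inP; exists u; rewrite ?set11 //.
by apply/exists_inP; exists v; rewrite ?set11.
Qed.

End Domatic.

Theorem theorem5 (R : realType) (V : finType) (D : rel V)
    (D_loopless : irreflexive D) (D_strong : strong D) (D_planar : planar R D) :
  (strong_in_domatic_number D <= 4)%N /\
  (strong_in_domatic_number D = 4%N <-> (#|V| = 4%N /\ complete_digraph D)).
Proof.
have le4 : strong_in_domatic_number D <= 4.
  by apply/bigmax_leqP => P domP; apply: (planar_domatic_le4 domP D_planar).
split=> //; split=> [eq4 | [V4 complete]].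
  (* If every such partition had at most 3 classes, so would the maximum, also over an empty
     family. *)
  have [P domP P4] : exists2 P, strong_in_domatic D P & 4 <= #|P|.
    have [P /andP[]|no_P] := pickP [pred P | strong_in_domatic D P & 4 <= #|P|].
      by exists P.
    suff: strong_in_domatic_number D <= 3 by rewrite eq4.
    apply/bigmax_leqP => P domP; rewrite leqNgt.
    by have := no_P P; rewrite /= domP /= => ->.
  have card1 S : S \in P -> #|S| = 1.
    exact: (planar_domatic_singletons domP D_planar D_loopless P4).
  have partP : finset.partition P [set: V] by case/andP: domP.
  split.
    rewrite -cardsT (card_uniform_partition card1 partP) muln1.
    by apply/eqP; rewrite eqn_leq P4 (planar_domatic_le4 domP D_planar).
  move=> u v; have [<-|uv] := eqVneq u v; first exact: D_loopless.
  (* The class of [v] is a singleton; its in-domination then forces the arc from [u] to [v]. *)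
  have vP : [set v] \in P.
    have v_cover : v \in finset.cover P by rewrite (cover_partition partP) inE.
    have SP := pblock_mem v_cover; have /eqP/cards1P[w Sw] := card1 _ SP.
    by move: v_cover SP; rewrite -mem_pblock Sw => /set1P ->.
  by have [|_ /set1P ->] := domatic_dominating domP vP (u := u); rewrite ?inE ?uv.
apply/eqP; rewrite eqn_leq le4 /=.
(* The partition into singletons attains the bound: completeness makes each of them
   in-dominating. *)
pose P := [set [set x] | x : V]%SET.
have P4 : #|P| = 4 by rewrite card_imset //; exact: set1_inj.
rewrite -P4; apply: leq_bigmax_cond; apply/andP; split; last first.
  apply/forall_inP => _ /imsetP[x _ ->]; apply/andP; split.
    apply/forallP => u; apply/implyP; rewrite inE => ux.
    by apply/exists_inP; exists x; rewrite ?set11 // complete.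
  apply/forallP => -[u ux]; apply/forallP => -[v vx].
  suff -> : exist _ u ux = exist _ v vx :> {y | y \in [set x]%SET} by exact: connect0.
  by apply: val_inj; move: ux vx => /= /set1P -> /set1P ->.
apply/and3P; split.
- rewrite finset.eqEsubset finset.subsetT; apply/fintype.subsetP => x _.
  by apply/finset.bigcupP; exists [set x]%SET; rewrite ?set11 // imset_f.
- apply/finset.trivIsetP => _ _ /imsetP[x _ ->] /imsetP[y _ ->] xy.
  by rewrite disjoints1 inE; apply: contraNneq xy => ->.
- by apply/imsetP => -[x _ /esym/eqP]; apply/negP; rewrite -card_gt0 cards1.
Qed.
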